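(* Let $R$ be a commutative ring with unit and let $G$ be a finite group. Let $U(G)$ be the set of units of the group algebra $R[G]$. The set $\mathcal{Q}(G)$ of quantizers of $G$-modules (the orbits of quantizations of $Mod_R(G)$ under the action of the unit preserving natural isomorphisms of the identity functor) is the orbit space of the following $U(G)$-action on $\mathbf{q}(G)$: $$l(q)\stackrel{\text{def}}{=}\Delta(l)\cdot q\cdot l^{-\otimes 2},\qquad l\in U(G),\ q\in\mathbf{q}(G),$$ where $l^{-\otimes 2}=l^{-1}\otimes l^{-1}$.
   Context: $Mod_R(G)$ is the monoidal category of finitely generated $G$-modules over $R$ (equivalently, $R[G]$-modules). The tensor product is over $R$ with diagonal $G$-action $g(x\otimes y)=g(x)\otimes g(y)$; the unit object is $R$ with trivial action. A quantization $Q$ of $Mod_R(G)$ is a natural transformation of the tensor bifunctor, i.e. a family of $G$-module morphisms $Q_{X,Y}:X\otimes Y\to X\otimes Y$ (not necessarily isomorphisms), natural in $X$ and $Y$, satisfying the coherence condition $Q_{X,Y\otimes Z}\circ(1\otimes Q_{Y,Z})=Q_{X\otimes Y,Z}\circ(Q_{X,Y}\otimes 1)$ for all $X,Y,Z$ (modulo the associativity isomorphism), and normalized: $Q_{X,R}=\mathrm{id}$, $Q_{R,X}=\mathrm{id}$. Every quantization has the form $Q_{X,Y}(x\otimes y)=q\cdot(x\otimes y)=\sum_{g,h\in G}q_{g,h}\,gx\otimes hy$ for an element $q=\sum_{g,h\in G}q_{g,h}(g,h)\in R[G\times G]$, called its quantizer. The set of quantizers, identified with the set of quantizations, is denoted $\mathbf{q}(G)\subset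 R[G\times G]$. A unit preserving natural isomorphism $\lambda$ of the identity functor (natural isomorphisms $\lambda_X:X\to X$ with $\lambda_R=\mathrm{id}_R$) acts on quantizations, $Q\mapsto\lambda(Q)$, by requiring $\lambda(Q)_{X,Y}\circ(\lambda_X\otimes\lambda_Y)=\lambda_{X\otimes Y}\circ Q_{X,Y}$. The set of orbits of this action is denoted $\mathcal{Q}(G)$. $\Delta:R[G]\to R[G]\otimes R[G]=R[G\times G]$ is the diagonal of $R[G]$, the $R$-linear map with $\Delta(g)=(g,g)$ for $g\in G$.
   Formalization: The full U(G) does not act on q(G) (l=2, G trivial, R=Q sends 1 to 1/2), so U(G) is replaced by the central units of R[G] of augmentation 1; for abelian G all of U(G) is allowed, with orbits taken inside q(G). *)

(* Defs.v *)
From HB Require Import structures.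
From mathcomp Require Import all_boot all_algebra all_fingroup.
From mathcomp Require Import generic_quotient boolp classical_sets functions.

Set Implicit Arguments.
Unset Strict Implicit.
Unset Printing Implicit Defensive.

Import GRing.Theory.

Local Open Scope ring_scope.
Local Open Scope quotient_scope.

(* A new constant, so that the product is convolution and not the pointwise
   product carried by {ffun gT -> R}. *)
Definition galg (R : comPzRingType) (gT : finGroupType) := {ffun gT -> R}.

Definition gbasis (R : comPzRingType) (gT : finGroupType) (g : gT) :
  galg R gT := [ffun k => (k == g)%:R].
Arguments gbasis R {gT} g.

Section GroupAlgebra.

Variables (R : comPzRingType) (gT : finGroupType).
Implicit Types a b c : galg R gT.

HB.instance Definition _ := GRing.Lmodule.copy (galg R gT) {ffun gT -> R^o}.

Definition galg_mul a b : galg R gT :=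
  [ffun k => \sum_(g : gT) a g * b (g^-1 * k)%g : R].

Fact galg_mulA : associative galg_mul.
Proof.
move=> a b c; apply/ffunP=> k; rewrite !ffunE.
under eq_bigr do rewrite ffunE big_distrr /=.
under [RHS]eq_bigr do rewrite ffunE big_distrl /=.
rewrite [RHS]exchange_big; apply: eq_bigr => g _ /=.
rewrite [RHS](reindex_inj (mulgI g)); apply: eq_bigr => h _ /=.
by rewrite mulKg invMg !mulgA mulrA.
Qed.

Fact galg_mul1l : left_id (gbasis R 1%g) galg_mul.
Proof.
move=> a; apply/ffunP=> k; rewrite !ffunE (bigD1 1%g) //= big1 ?addr0.
  by rewrite ffunE eqxx mul1r invg1 mul1g.
by move=> g /negPf ng; rewrite ffunE ng mul0r.
Qed.

Fact galg_mul1r : right_id (gbasis R 1%g) galg_mul.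
Proof.
move=> a; apply/ffunP=> k; rewrite !ffunE (bigD1 k) //= big1 ?addr0.
  by rewrite ffunE mulVg eqxx mulr1.
by move=> g /negPf ng; rewrite ffunE -eq_mulVg1 ng mulr0.
Qed.

Fact galg_mulDl : left_distributive galg_mul +%R.
Proof.
move=> a b c; apply/ffunP=> k; rewrite !ffunE -big_split /=.
by apply: eq_bigr => g _; rewrite ffunE mulrDl.
Qed.

Fact galg_mulDr : right_distributive galg_mul +%R.
Proof.
move=> a b c; apply/ffunP=> k; rewrite !ffunE -big_split /=.
by apply: eq_bigr => g _; rewrite ffunE mulrDr.
Qed.

HB.instance Definition _ := GRing.Zmodule_isPzRing.Build (galg R gT)
  galg_mulA galg_mul1l galg_mul1r galg_mulDl galg_mulDr.

End GroupAlgebra.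

Section GroupAlgebraTheory.

Variables (R : comPzRingType) (gT : finGroupType).
Implicit Types a b : galg R gT.

Lemma galg_scaleE (c : R) a k : (c *: a) k = c * a k.
Proof. by rewrite ffunE. Qed.

Definition augmentation a : R := \sum_(g : gT) a g.

Definition galg_diag a : galg R (gT * gT)%type :=
  \sum_(g : gT) a g *: gbasis R (g, g).

(* a (x) b in R[G] (x) R[G] = R[G x G] *)
Definition galg_tens a b : galg R (gT * gT)%type :=
  [ffun p => a p.1 * b p.2 : R].

Lemma augmentation1 : augmentation 1 = 1.
Proof.
rewrite /augmentation (bigD1 1%g) //= big1 ?addr0 ?ffunE ?eqxx //.
by move=> g /negPf ng; rewrite ffunE ng.
Qed.

Lemma augmentationM a b :
  augmentation (a * b) = augmentation a * augmentation b.
Proof.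
rewrite /augmentation big_distrl /=; under eq_bigr do rewrite ffunE.
rewrite exchange_big; apply: eq_bigr => g _; rewrite big_distrr /=.
rewrite (reindex_inj (mulgI g)); apply: eq_bigr => h _ /=.
by rewrite mulKg.
Qed.

Record gunit := GUnit {
  gunit_val :> galg R gT;
  gunit_inv : galg R gT;
  gunit_mulV : gunit_val * gunit_inv = 1;
  gunit_Vmul : gunit_inv * gunit_val = 1 }.

Definition gunit_one : gunit := GUnit (mulr1 1) (mulr1 1).

Fact gunit_mul_subproof1 (l m : gunit) :
  gunit_val l * gunit_val m * (gunit_inv m * gunit_inv l) = 1.
Proof. by rewrite mulrA -(mulrA (gunit_val l)) gunit_mulV mulr1 gunit_mulV. Qed.

Fact gunit_mul_subproof2 (l m : gunit) :
  gunit_inv m * gunit_inv l * (gunit_val l * gunit_val m) = 1.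
Proof. by rewrite mulrA -(mulrA (gunit_inv m)) gunit_Vmul mulr1 gunit_Vmul. Qed.

Definition gunit_mul (l m : gunit) : gunit :=
  GUnit (gunit_mul_subproof1 l m) (gunit_mul_subproof2 l m).

Definition gunit_inverse (l : gunit) : gunit :=
  GUnit (gunit_Vmul l) (gunit_mulV l).

Definition gunit_act (l : gunit) (q : galg R (gT * gT)%type) :
    galg R (gT * gT)%type :=
  galg_diag l * q * galg_tens (gunit_inv l) (gunit_inv l).

End GroupAlgebraTheory.

Lemma linear_fun0 (R : pzRingType) (U V : lmodType R) (f : U -> V) :
  linear f -> f 0 = 0.
Proof.
by move=> fL; have := fL (-1) 0 0; rewrite scaler0 add0r scaleN1r addNr.
Qed.

Section Tensor.

Variables (R : comPzRingType) (X Y : lmodType R).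
Implicit Types (x : X) (y : Y) (s t u : seq (X * Y)).

(* [:: (x1, y1); ...; (xn, yn)] stands for the formal sum of the pure tensors
   xi (x) yi; two such sums are identified by the congruence generated by
   commutativity and bilinearity.  Opposites need not be added formally, since
   (- x, y) is an opposite of (x, y) in the quotient. *)
Inductive tens_cong : seq (X * Y) -> seq (X * Y) -> Prop :=
| tens_refl s : tens_cong s s
| tens_sym s t : tens_cong s t -> tens_cong t s
| tens_trans s t u : tens_cong s t -> tens_cong t u -> tens_cong s u
| tens_cat s s' t t' :
    tens_cong s s' -> tens_cong t t' -> tens_cong (s ++ t) (s' ++ t')
| tens_catC s t : tens_cong (s ++ t) (t ++ s)
| tens_0l y : tens_cong [:: (0, y)] [::]
| tens_Dl x x' y : tens_cong [:: (x + x', y)] [:: (x, y); (x', y)]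
| tens_Dr x y y' : tens_cong [:: (x, y + y')] [:: (x, y); (x, y')]
| tens_Z c x y : tens_cong [:: (c *: x, y)] [:: (x, c *: y)].

Definition tens_rel s t : bool := `[< tens_cong s t >].

Fact tens_rel_refl : reflexive tens_rel.
Proof. by move=> s; apply/asboolP; exact: tens_refl. Qed.

Fact tens_rel_sym : symmetric tens_rel.
Proof.
by move=> s t; apply/asboolP/asboolP; exact: tens_sym.
Qed.

Fact tens_rel_trans : transitive tens_rel.
Proof.
by move=> t s u /asboolP st /asboolP tu; apply/asboolP; exact: tens_trans st tu.
Qed.

Canonical tens_equiv : equiv_rel (seq (X * Y)) :=
  EquivRel tens_rel tens_rel_refl tens_rel_sym tens_rel_trans.

Definition tens := {eq_quot tens_equiv}.

HB.instance Definition _ := Choice.on tens.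

Definition tens_class s : tens := \pi_tens s.

Lemma tens_classP s t : tens_class s = tens_class t <-> tens_cong s t.
Proof.
split=> [st|st]; last by apply/eqmodP/asboolP.
by have /eqmodP/asboolP := st.
Qed.

Lemma tens_reprK (v : tens) : tens_class (repr v) = v.
Proof. exact: reprK. Qed.

Lemma tens_classK s : tens_cong (repr (tens_class s)) s.
Proof. by apply/tens_classP; exact: tens_reprK. Qed.

Lemma tens_map_cong (f : X * Y -> seq (X * Y)) :
  (forall y, tens_cong (f (0, y)) [::]) ->
  (forall x x' y, tens_cong (f (x + x', y)) (f (x, y) ++ f (x', y))) ->
  (forall x y y', tens_cong (f (x, y + y')) (f (x, y) ++ f (x, y'))) ->
  (forall c x y, tens_cong (f (c *: x, y)) (f (x, c *: y))) ->
  forall s t, tens_cong s t ->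
    tens_cong (flatten (map f s)) (flatten (map f t)).
Proof.
move=> f0 fDl fDr fZ s t; elim=> {s t} /=.
- by move=> s; exact: tens_refl.
- by move=> s t _; exact: tens_sym.
- by move=> s t u _ st _; exact: tens_trans.
- by move=> s s' t t' _ ss' _ tt'; rewrite !map_cat !flatten_cat; exact: tens_cat.
- by move=> s t; rewrite !map_cat !flatten_cat; exact: tens_catC.
- by move=> y; rewrite cats0.
- by move=> x x' y; rewrite !cats0.
- by move=> x y y'; rewrite !cats0.
- by move=> c x y; rewrite !cats0.
Qed.

Definition tens_add (u v : tens) : tens := tens_class (repr u ++ repr v).
Definition tens_zero : tens := tens_class [::].
Definition tens_scale (c : R) (u : tens) : tens :=
  tens_class [seq (c *: p.1, p.2) | p <- repr u].
Definition tens_opp (u : tens) : tens := tens_scale (-1) u.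

Lemma tens_class_cat s t :
  tens_class (s ++ t) = tens_add (tens_class s) (tens_class t).
Proof.
by apply/tens_classP/tens_cat; apply: tens_sym; exact: tens_classK.
Qed.

Lemma tens_cong_scale c s t : tens_cong s t ->
  tens_cong [seq (c *: p.1, p.2) | p <- s] [seq (c *: p.1, p.2) | p <- t].
Proof.
have E r : [seq (c *: p.1, p.2) | p <- r] =
    flatten [seq [:: (c *: p.1, p.2)] | p : X * Y <- r].
  by elim: r => //= p r ->.
rewrite !E; apply: tens_map_cong => /= [y|x x' y|x y y'|d x y].
- by rewrite scaler0; exact: tens_0l.
- by rewrite scalerDr; exact: tens_Dl.
- exact: tens_Dr.
- by rewrite scalerA mulrC -scalerA; exact: tens_Z.
Qed.

Lemma tens_class_scale c s :
  tens_class [seq (c *: p.1, p.2) | p <- s] = tens_scale c (tens_class s).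
Proof.
by apply/tens_classP/tens_cong_scale/tens_sym; exact: tens_classK.
Qed.

Fact tens_addA : associative tens_add.
Proof.
move=> u v w; rewrite -[u]tens_reprK -[v]tens_reprK -[w]tens_reprK.
by rewrite -!tens_class_cat catA.
Qed.

Fact tens_addC : commutative tens_add.
Proof. by move=> u v; apply/tens_classP; exact: tens_catC. Qed.

Fact tens_add0 : left_id tens_zero tens_add.
Proof. by move=> u; rewrite -[u]tens_reprK -tens_class_cat. Qed.

Fact tens_scaleDl_class c d s : tens_class [seq ((c + d) *: p.1, p.2) | p <- s] =
  tens_add (tens_class [seq (c *: p.1, p.2) | p <- s])
           (tens_class [seq (d *: p.1, p.2) | p <- s]).
Proof.
elim: s => [|[x y] s IHs] /=; first by rewrite tens_add0.
rewrite -cat1s tens_class_cat IHs scalerDl.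
rewrite -[in RHS]cat1s -[in X in _ = tens_add _ X]cat1s !tens_class_cat.
rewrite -!tens_addA [in RHS](tens_addC (tens_class [:: (d *: x, y)])).
rewrite [in RHS]tens_addA.
have -> : tens_class [:: (c *: x + d *: x, y)] =
    tens_add (tens_class [:: (c *: x, y)]) (tens_class [:: (d *: x, y)]).
  by rewrite -tens_class_cat; apply/tens_classP; exact: tens_Dl.
by rewrite -!tens_addA; congr tens_add; rewrite tens_addC -!tens_addA.
Qed.

Fact tens_scaleDl (u : tens) :
  {morph tens_scale^~ u : c d / c + d >-> tens_add c d}.
Proof. by move=> c d; exact: tens_scaleDl_class. Qed.

Fact tens_scale0 (u : tens) : tens_scale 0 u = tens_zero.
Proof.
rewrite /tens_scale; elim: (repr u) => //= p s IHs.
rewrite -cat1s tens_class_cat IHs scale0r tens_addC tens_add0.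
by apply/tens_classP; exact: tens_0l.
Qed.

Fact tens_scale1 : left_id 1 tens_scale.
Proof.
move=> u; rewrite -[RHS]tens_reprK /tens_scale; congr tens_class.
by elim: (repr u) => //= -[x y] s ->; rewrite scale1r.
Qed.

Fact tens_addN : left_inverse tens_zero tens_opp tens_add.
Proof.
move=> u; rewrite -{2}[u]tens_scale1 /tens_opp -tens_scaleDl.
by rewrite addNr tens_scale0.
Qed.

HB.instance Definition _ :=
  GRing.isZmodule.Build tens tens_addA tens_addC tens_add0 tens_addN.

Fact tens_scaleA c d (u : tens) :
  tens_scale c (tens_scale d u) = tens_scale (c * d) u.
Proof.
rewrite -[u]tens_reprK -!tens_class_scale -map_comp; congr tens_class.
by apply: eq_map => p /=; rewrite scalerA.
Qed.

Fact tens_scaleDr : right_distributive tens_scale +%R.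
Proof.
move=> c u v; rewrite -[u]tens_reprK -[v]tens_reprK.
by rewrite -[_ + _]tens_class_cat -!tens_class_scale map_cat tens_class_cat.
Qed.

HB.instance Definition _ := GRing.Zmodule_isLmodule.Build R tens
  tens_scaleA tens_scale1 tens_scaleDr tens_scaleDl.

Definition pure x y : tens := tens_class [:: (x, y)].

Lemma pureDl x x' y : pure (x + x') y = pure x y + pure x' y.
Proof.
by rewrite -[RHS]tens_class_cat; apply/tens_classP; exact: tens_Dl.
Qed.

Lemma pureDr x y y' : pure x (y + y') = pure x y + pure x y'.
Proof.
by rewrite -[RHS]tens_class_cat; apply/tens_classP; exact: tens_Dr.
Qed.

Lemma pureZl c x y : pure (c *: x) y = c *: pure x y.
Proof. exact: tens_class_scale c [:: (x, y)]. Qed.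

Lemma pureZr c x y : pure x (c *: y) = c *: pure x y.
Proof.
by rewrite -pureZl; apply/esym/tens_classP; exact: tens_Z.
Qed.

Lemma tens_classE s : tens_class s = \sum_(p <- s) pure p.1 p.2.
Proof.
elim: s => [|[x y] s IHs]; first by rewrite big_nil.
by rewrite big_cons -cat1s tens_class_cat IHs.
Qed.

Lemma tens_ind_pure (P : tens -> Prop) :
  P 0 -> (forall u v : tens, P u -> P v -> P (u + v)) ->
  (forall x y, P (pure x y)) -> forall u : tens, P u.
Proof.
move=> P0 PD Pp u; rewrite -[u]tens_reprK tens_classE.
by elim/big_ind: _ => // p _; exact: Pp.
Qed.

Definition bilin (Z : lmodType R) (b : X -> Y -> Z) :=
  (forall y, linear (b^~ y)) /\ (forall x, linear (b x)).

Section Lift.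

Variables (Z : lmodType R) (b : X -> Y -> Z) (bP : bilin b).

Definition tens_lift_fun of bilin b := fun u : tens =>
  \sum_(p <- repr u) b p.1 p.2.

Let lift := tens_lift_fun bP.

Fact tens_lift_class s : lift (tens_class s) = \sum_(p <- s) b p.1 p.2.
Proof.
rewrite /lift /tens_lift_fun; case: (bP) => bl br.
have b0 y : b 0 y = 0 := linear_fun0 (bl y).
have br0 x : b x 0 = 0 := linear_fun0 (br x).
suff E r t : tens_cong r t ->
    \sum_(p <- r) b p.1 p.2 = \sum_(p <- t) b p.1 p.2 by apply/E/tens_classK.
elim=> {r t s} //.
- by move=> r t u _ -> _ ->.
- by move=> r r' t t' _ rr' _ tt'; rewrite !big_cat /= rr' tt'.
- by move=> r t; rewrite !big_cat /= addrC.
- by move=> y; rewrite big_seq1 big_nil b0.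
- by move=> x x' y; rewrite !big_cons !big_nil /= !addr0 -[x]scale1r bl !scale1r.
- by move=> x y y'; rewrite !big_cons !big_nil /= !addr0 -[y]scale1r br !scale1r.
- move=> c x y; rewrite !big_seq1 -[c *: x]addr0 bl b0 addr0.
  by rewrite -[c *: y]addr0 br br0 addr0.
Qed.

Fact tens_lift_is_linear : linear lift.
Proof.
move=> c u v; rewrite -[u]tens_reprK -[v]tens_reprK -[c *: _]tens_class_scale.
rewrite -[_ + _]tens_class_cat !tens_lift_class big_cat big_map /=.
congr (_ + _); rewrite scaler_sumr; apply: eq_bigr => -[x y] _ /=.
case: (bP) => bl br; rewrite -[c *: x]addr0 bl.
by rewrite (linear_fun0 (bl y)) addr0.
Qed.

HB.instance Definition _ := GRing.isLinear.Build R tens Z *:%R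
  (tens_lift_fun bP) tens_lift_is_linear.

Definition tens_lift : {linear tens -> Z} := tens_lift_fun bP.

Lemma tens_liftE x y : tens_lift (pure x y) = b x y.
Proof. by rewrite [LHS]tens_lift_class big_seq1. Qed.

End Lift.

End Tensor.

Section TensorMaps.

Variable R : comPzRingType.

Fact tens_map_bilin (X X' Y Y' : lmodType R)
    (f : {linear X -> X'}) (h : {linear Y -> Y'}) :
  bilin (fun x y => pure (f x) (h y)).
Proof.
split=> [y c x x'|x c y y']; first by rewrite linearP pureDl pureZl.
by rewrite linearP pureDr pureZr.
Qed.

Definition tens_map (X X' Y Y' : lmodType R)
    (f : {linear X -> X'}) (h : {linear Y -> Y'}) :
    {linear tens X Y -> tens X' Y'} :=
  tens_lift (tens_map_bilin f h).

Lemma tens_mapE (X X' Y Y' : lmodType R)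
    (f : {linear X -> X'}) (h : {linear Y -> Y'}) x y :
  tens_map f h (pure x y) = pure (f x) (h y).
Proof. exact: tens_liftE. Qed.

Section Associator.

Variables X Y Z : lmodType R.

Fact tens_assoc_bilin1 (z : Z) :
  bilin (fun (x : X) (y : Y) => pure x (pure y z)).
Proof.
split=> [y c x x'|x c y y']; first by rewrite pureDl pureZl.
by rewrite pureDl pureZl pureDr pureZr.
Qed.

Fact tens_assoc_bilin2 :
  bilin (fun (u : tens X Y) (z : Z) => tens_lift (tens_assoc_bilin1 z) u).
Proof.
split=> [z|u c z z']; first exact: linearP.
elim/tens_ind_pure: u => [|u v IHu IHv|x y].
- by rewrite !raddf0 addr0.
- by rewrite !raddfD /= IHu IHv addrACA.
- by rewrite !tens_liftE !pureDr !pureZr.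
Qed.

(* (x (x) y) (x) z |-> x (x) (y (x) z) *)
Definition tens_assoc : {linear tens (tens X Y) Z -> tens X (tens Y Z)} :=
  tens_lift tens_assoc_bilin2.

Lemma tens_assocE x y z :
  tens_assoc (pure (pure x y) z) = pure x (pure y z).
Proof. by rewrite !tens_liftE. Qed.

End Associator.

End TensorMaps.

Section GModules.

Variables (R : comPzRingType) (gT : finGroupType).

Record gmod := GMod {
  gmod_sort :> lmodType R;
  gact : gT -> {linear gmod_sort -> gmod_sort};
  gact1 : forall x, gact 1%g x = x;
  gactM : forall g h x, gact (g * h)%g x = gact g (gact h x);
  gmod_fg : exists (n : nat) (s : 'I_n -> gmod_sort), forall x,
    exists a : 'I_n -> galg R gT,
      x = \sum_(i < n) \sum_(g : gT) a i g *: gact g (s i) }.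

Record ghom (X Y : gmod) := GHom {
  ghom_fun :> {linear X -> Y};
  ghom_equivariant : forall g x, ghom_fun (gact X g x) = gact Y g (ghom_fun x) }.

Definition ghom_id (X : gmod) : ghom X X :=
  @GHom X X idfun (fun g x => erefl).

Section GTensor.

Variables X Y : gmod.

Definition gtens_act (g : gT) : {linear tens X Y -> tens X Y} :=
  tens_map (gact X g) (gact Y g).

Fact gtens_act1 u : gtens_act 1%g u = u.
Proof.
elim/tens_ind_pure: u => [|u v IHu IHv|x y]; first exact: raddf0.
  by rewrite raddfD /= IHu IHv.
by rewrite tens_mapE !gact1.
Qed.

Fact gtens_actM g h u : gtens_act (g * h)%g u = gtens_act g (gtens_act h u).
Proof.
elim/tens_ind_pure: u => [|u v IHu IHv|x y]; first by rewrite !raddf0.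
  by rewrite !raddfD /= IHu IHv.
by rewrite !tens_mapE !gactM.
Qed.

Fact gtens_fg : exists (n : nat) (s : 'I_n -> tens X Y), forall u,
  exists a : 'I_n -> galg R gT,
    u = \sum_(i < n) \sum_(g : gT) a i g *: gtens_act g (s i).
Proof.
have [n [s sP]] := gmod_fg X; have [m [t tP]] := gmod_fg Y.
pose I : finType := (('I_n * gT) * ('I_m * gT))%type.
pose gen (k : I) : tens X Y :=
  pure (gact X k.1.2 (s k.1.1)) (gact Y k.2.2 (t k.2.1)).
suff genP u : exists c : I -> R, u = \sum_k c k *: gen k.
  exists #|I|, (gen \o enum_val) => u; have [c ->] := genP u.
  exists (fun i => c (enum_val i) *: gbasis R 1%g).
  rewrite (reindex (@enum_val I predT)) /=; last first.
    by apply: onW_bij; exact: enum_val_bij.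
  apply: eq_bigr => i _; rewrite (bigD1 1%g) //= big1 ?addr0.
    by rewrite gtens_act1 galg_scaleE ffunE eqxx mulr1.
  by move=> g /negPf ng; rewrite galg_scaleE ffunE ng mulr0 scale0r.
elim/tens_ind_pure: u => [|u v [c ->] [d ->]|x y].
- by exists (fun=> 0); rewrite big1 // => k _; rewrite scale0r.
- exists (fun k => c k + d k); rewrite -big_split.
  by apply: eq_bigr => k _; rewrite scalerDl.
have [a ->] := sP x; have [b ->] := tP y.
exists (fun k => a k.1.1 k.1.2 * b k.2.1 k.2.2).
rewrite !pair_bigA /= -(pair_bigA _ (fun p q => (a p.1 p.2 * b q.1 q.2) *:
  pure (gact X p.2 (s p.1)) (gact Y q.2 (t q.1)))) /=.
rewrite (big_morph (fun x => pure x _) (fun x x' => pureDl x x' _) (id1 := 0)); last first.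
  by rewrite -(scale0r 0) pureZl scale0r.
apply: eq_bigr => p _.
rewrite (big_morph (pure _) (pureDr _) (id1 := 0)); last first.
  by rewrite -(scale0r 0) pureZr scale0r.
by apply: eq_bigr => q _; rewrite pureZl pureZr scalerA.
Qed.

Definition gtens : gmod := GMod gtens_act1 gtens_actM gtens_fg.

End GTensor.

Fact ghom_tens_equivariant (X X' Y Y' : gmod) (f : ghom X X') (h : ghom Y Y')
    (g : gT) (u : gtens X Y) :
  tens_map f h (gact (gtens X Y) g u) =
  gact (gtens X' Y') g (tens_map f h u).
Proof.
elim/tens_ind_pure: u => [|u v IHu IHv|x y]; first by rewrite !raddf0.
  by rewrite !raddfD /= IHu IHv.
by rewrite /= !tens_mapE !ghom_equivariant.
Qed.

Definition ghom_tens (X X' Y Y' : gmod) (f : ghom X X') (h : ghom Y Y') :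
    ghom (gtens X Y) (gtens X' Y') :=
  @GHom (gtens X Y) (gtens X' Y') (tens_map f h) (ghom_tens_equivariant f h).

Fact gunit_mod_fg : exists (n : nat) (s : 'I_n -> R^o), forall x : R^o,
  exists a : 'I_n -> galg R gT,
    x = \sum_(i < n) \sum_(g : gT) a i g *: (idfun : {linear R^o -> R^o}) (s i).
Proof.
exists 1%N, (fun=> 1) => x; exists (fun=> (x : R) *: gbasis R (1%g : gT)).
rewrite big_ord1 (bigD1 1%g) //= big1 ?addr0.
  by rewrite galg_scaleE ffunE eqxx mulr1 [RHS]mulr1.
by move=> g /negPf ng; rewrite galg_scaleE ffunE ng mulr0 scale0r.
Qed.

(* R with the trivial action *)
Definition gtriv : gmod :=
  @GMod R^o (fun=> idfun) (fun=> erefl) (fun _ _ _ => erefl) gunit_mod_fg.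

Record quantization := Quantization {
  quant_map :> forall X Y : gmod, ghom (gtens X Y) (gtens X Y);
  quant_natural : forall (X X' Y Y' : gmod) (f : ghom X X') (h : ghom Y Y') u,
    ghom_tens f h (quant_map X Y u) = quant_map X' Y' (ghom_tens f h u);
  quant_coherent : forall (X Y Z : gmod) (u : gtens (gtens X Y) Z),
    quant_map X (gtens Y Z)
      (ghom_tens (ghom_id X) (quant_map Y Z) (tens_assoc X Y Z u)) =
    tens_assoc X Y Z
      (quant_map (gtens X Y) Z (ghom_tens (quant_map X Y) (ghom_id Z) u));
  quant_unitr : forall (X : gmod) (u : gtens X gtriv), quant_map X gtriv u = u;
  quant_unitl : forall (X : gmod) (u : gtens gtriv X), quant_map gtriv X u = u }.

(* Unit preserving natural automorphisms of the identity functor. *)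
Record natiso := NatIso {
  natiso_map :> forall X : gmod, ghom X X;
  natiso_natural : forall (X Y : gmod) (f : ghom X Y) x,
    f (natiso_map X x) = natiso_map Y (f x);
  natiso_iso : forall X : gmod, exists mu : ghom X X,
    cancel (natiso_map X) mu /\ cancel mu (natiso_map X);
  natiso_unit : forall r : gtriv, natiso_map gtriv r = r }.

(* Q' = lam(Q), stated without inverting lam. *)
Definition natiso_act (lam : natiso) (Q Q' : quantization) :=
  forall (X Y : gmod) (u : gtens X Y),
    Q' X Y (ghom_tens (lam X) (lam Y) u) = lam (gtens X Y) (Q X Y u).

Definition quantizes (q : galg R (gT * gT)%type) (Q : quantization) :=
  forall (X Y : gmod) (x : X) (y : Y),
    Q X Y (pure x y) =
    \sum_(p : gT * gT) q p *: pure (gact X p.1 x) (gact Y p.2 y).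

Lemma quantizes_inj q Q Q' : quantizes q Q -> quantizes q Q' ->
  forall (X Y : gmod) (u : gtens X Y), Q X Y u = Q' X Y u.
Proof.
move=> qQ qQ' X Y u; elim/tens_ind_pure: u => [|u v IHu IHv|x y].
- by rewrite !raddf0.
- by rewrite !raddfD /= IHu IHv.
- by rewrite qQ qQ'.
Qed.

Local Open Scope classical_set_scope.

Definition quantizers : set (galg R (gT * gT)%type) :=
  [set q | exists Q, quantizes q Q].

(* The orbit of q under the natural isomorphisms, the quantizations being
   identified with their quantizers. *)
Definition natiso_orbit (q : galg R (gT * gT)%type) :
    set (galg R (gT * gT)%type) :=
  [set q' | exists (lam : natiso) (Q Q' : quantization),
    [/\ quantizes q Q, quantizes q' Q' & natiso_act lam Q Q']].

(* The orbit set of the quantizations.  It is formed inside the set of sets of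
   quantizers, because classical sets of elements of the large type
   quantization are not available for universe reasons. *)
Definition natiso_orbits : set (set (galg R (gT * gT)%type)) :=
  [set natiso_orbit q | q in quantizers].

(* The orbits, inside q(G), of the relation q' = l(q) with l ranging over a
   set U of units.  The set U need not act on q(G). *)
Definition gunit_orbit (U : set (gunit R gT)) (q : galg R (gT * gT)%type) :
    set (galg R (gT * gT)%type) :=
  [set q' | quantizers q' /\ exists2 l, U l & q' = gunit_act l q].

Definition gunit_orbits (U : set (gunit R gT)) :
    set (set (galg R (gT * gT)%type)) :=
  [set gunit_orbit U q | q in quantizers].

(* For a unit l, x |-> l x is a G-module morphism on every X only if l is
   central, and fixes the unit object only if l has augmentation 1.  For other
   units, l(q) need not be a quantizer when q is. *)
Definition natural_units : set (gunit R gT) :=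
  [set l | (forall a, gunit_val l * a = a * gunit_val l)
           /\ augmentation (gunit_val l) = 1].

Lemma natural_units1 : natural_units (gunit_one R gT).
Proof. by split=> [a|]; rewrite ?mul1r ?mulr1 ?augmentation1. Qed.

Lemma natural_unitsM l m :
  natural_units l -> natural_units m -> natural_units (gunit_mul l m).
Proof.
move=> [lC l1] [mC m1]; split=> [a|] /=.
  by rewrite -mulrA mC mulrA lC mulrA.
by rewrite augmentationM l1 m1 mulr1.
Qed.

Lemma natural_unitsV l : natural_units l -> natural_units (gunit_inverse l).
Proof.
move=> [lC l1]; split=> [a|] /=.
  rewrite -[a in LHS]mulr1 -(gunit_mulV l) (mulrA a) -lC !mulrA gunit_Vmul.
  by rewrite mul1r.
by rewrite -[LHS]mul1r -l1 -augmentationM gunit_mulV augmentation1.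
Qed.

End GModules.

Arguments quantizers R gT : clear implicits.
Arguments natiso_orbits R gT : clear implicits.
Arguments natural_units R gT : clear implicits.

(* Main.v *)
From HB Require Import structures.
From Pilot Require Import Defs.
From mathcomp Require Import all_boot all_algebra all_fingroup.
From mathcomp Require Import boolp classical_sets.
Import Pilot.Defs.

Set Implicit Arguments.
Unset Strict Implicit.
Unset Printing Implicit Defensive.

Import GRing.Theory.

Local Open Scope ring_scope.
Local Open Scope classical_set_scope.

(** The group algebra A = R[G], as a left module over itself, represents the
    forgetful functor: a G-module morphism A -> X is the same as an element x
    of X, through a |-> a x (orbit_hom).  Hence a natural transformation is
    known as soon as it is known at 1.

    A quantization Q commutes with orbit_hom x (x) orbit_hom y, which sends
    1 (x) 1 to x (x) y, so Q is determined by Q (1 (x) 1) in A (x) A, that is,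
    by an element q of R[G x G].  This q is unique because q |-> q (1 (x) 1)
    is injective (galg2_act_inj); the injectivity turns every identity between
    actions on tensor products into an identity in R[G x G].

    In the same way a natural automorphism lam of the identity functor is the
    action of l = lam 1.  Evaluating lam at a in A both by naturality and by
    linearity over A gives l a = a l, and evaluating it on the unit object
    shows that the augmentation of l is 1.  So unit preserving natural
    automorphisms are the central units of augmentation 1
    (natiso_unit_exists, unit_natiso), and the condition relating Q and lam(Q),
    evaluated at 1 (x) 1, reads q' (l (x) l) = Delta(l) q, i.e. q' = l(q)
    (natiso_actP).  That l(q) is again a quantizer is seen by constructing
    lam o Q o (lam^-1 (x) lam^-1), which inherits all the axioms from Q
    (transport).

    For abelian G every unit is central, and only the augmentation matters.
    Normalization forces a quantizer to have augmentation 1; since the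
    augmentation of l(q) is that of q divided by that of l, a unit carrying a
    quantizer to a quantizer has augmentation 1 by itself. *)

(** * The action of R[G] on G-modules, and the regular module *)

Section GroupAlgebraModule.

Variables (R : comPzRingType) (gT : finGroupType).
Implicit Types (a b : galg R gT) (X Y Z : gmod R gT).

Definition galg_act X a (x : X) : X := \sum_(g : gT) a g *: gact X g x.

Fact galg_act_is_linear X a : linear (@galg_act X a).
Proof.
move=> c x y; rewrite /galg_act scaler_sumr -big_split /=.
by apply: eq_bigr => g _; rewrite linearP scalerDr !scalerA mulrC.
Qed.

HB.instance Definition _ X a := GRing.isLinear.Build R X X *:%R
  (@galg_act X a) (@galg_act_is_linear X a).

Lemma galg_actDl X a b (x : X) :
  galg_act (a + b) x = galg_act a x + galg_act b x.
Proof.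
rewrite -big_split; apply: eq_bigr => g _.
by rewrite [(a + b) g]ffunE scalerDl.
Qed.

Lemma galg_actZl X c a (x : X) : galg_act (c *: a) x = c *: galg_act a x.
Proof.
rewrite scaler_sumr; apply: eq_bigr => g _.
by rewrite galg_scaleE scalerA.
Qed.

Lemma galg_act_basis X g (x : X) : galg_act (gbasis R g) x = gact X g x.
Proof.
rewrite /galg_act (bigD1 g) //= ffunE eqxx scale1r big1 ?addr0 // => h.
by move=> /negPf nh; rewrite ffunE nh scale0r.
Qed.

Lemma galg_act1 X (x : X) : galg_act 1 x = x.
Proof. by rewrite galg_act_basis gact1. Qed.

Lemma galg_actM X a b (x : X) : galg_act (a * b) x = galg_act a (galg_act b x).
Proof.
rewrite /galg_act; under eq_bigr do rewrite ffunE scaler_suml.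
rewrite exchange_big; apply: eq_bigr => g _ /=.
rewrite linear_sum scaler_sumr (reindex_inj (mulgI g)).
apply: eq_bigr => h _ /=.
by rewrite mulKg linearZ gactM scalerA.
Qed.

Lemma ghom_galg_act X Y (f : ghom X Y) a x :
  f (galg_act a x) = galg_act a (f x).
Proof.
rewrite linear_sum; apply: eq_bigr => g _.
by rewrite linearZ ghom_equivariant.
Qed.

Lemma galg_act_triv a (r : gtriv R gT) :
  galg_act a r = augmentation a *: r.
Proof. by rewrite /augmentation scaler_suml. Qed.

Definition gregular_act (g : gT) a : galg R gT := [ffun k => a (g^-1 * k)%g].

Fact gregular_act_is_linear g : linear (gregular_act g).
Proof. by move=> c a b; apply/ffunP=> k; rewrite !ffunE. Qed.

HB.instance Definition _ g := GRing.isLinear.Build R (galg R gT) (galg R gT)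
  *:%R (gregular_act g) (gregular_act_is_linear g).

Lemma sum_gregular_act a b : \sum_(g : gT) a g *: gregular_act g b = a * b.
Proof.
apply/ffunP=> k; rewrite sum_ffunE !ffunE.
by apply: eq_bigr => g _; rewrite galg_scaleE ffunE.
Qed.

Fact gregular_act1 a : gregular_act 1%g a = a.
Proof. by apply/ffunP=> k; rewrite ffunE invg1 mul1g. Qed.

Fact gregular_actM g h a :
  gregular_act (g * h)%g a = gregular_act g (gregular_act h a).
Proof. by apply/ffunP=> k; rewrite !ffunE invMg mulgA. Qed.

Fact gregular_fg : exists (n : nat) (s : 'I_n -> galg R gT), forall x,
  exists a : 'I_n -> galg R gT,
    x = \sum_(i < n) \sum_(g : gT) a i g *: gregular_act g (s i).
Proof.
exists 1%N, (fun=> 1) => x; exists (fun=> x).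
by rewrite big_ord1 sum_gregular_act mulr1.
Qed.

Definition gregular : gmod R gT :=
  @GMod R gT (galg R gT) (fun g => gregular_act g : {linear _ -> _})
    gregular_act1 gregular_actM gregular_fg.

Lemma galg_act_regular a (b : gregular) : galg_act a b = a * (b : galg R gT).
Proof. exact: sum_gregular_act. Qed.

Section Orbit.

Variables (X : gmod R gT) (x : X).

Definition orbit_map (a : gregular) : X := galg_act a x.

Fact orbit_map_is_linear : linear orbit_map.
Proof. by move=> c a b; rewrite /orbit_map galg_actDl galg_actZl. Qed.

HB.instance Definition _ := GRing.isLinear.Build R gregular X *:%R
  orbit_map orbit_map_is_linear.

Fact orbit_map_equivariant g a :
  orbit_map (gact gregular g a) = gact X g (orbit_map a).
Proof.
rewrite -galg_act_basis galg_act_regular /orbit_map galg_actM.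
by rewrite galg_act_basis.
Qed.

Definition orbit_hom : ghom gregular X :=
  @GHom R gT gregular X orbit_map orbit_map_equivariant.

Lemma orbit_hom1 : orbit_hom (1 : galg R gT) = x.
Proof. exact: galg_act1. Qed.

End Orbit.

Lemma ghom_regularE X (f : ghom gregular X) a :
  f a = galg_act a (f (1 : galg R gT)).
Proof. by rewrite -ghom_galg_act galg_act_regular mulr1. Qed.

(** * The action of R[G x G] on tensor products *)

(** A quantizer is an element whose action realizes the quantization
    (quantizesP); working with the action on all tensors makes the product of
    R[G x G] a composition of maps. *)
Definition galg2_act X Y (q : galg R (gT * gT)%type) (u : gtens X Y) :
    gtens X Y :=
  \sum_(p : gT * gT) q p *: tens_map (gact X p.1) (gact Y p.2) u.

Fact galg2_act_is_linear X Y q : linear (@galg2_act X Y q).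
Proof.
move=> c u v; rewrite /galg2_act scaler_sumr -big_split /=.
by apply: eq_bigr => g _; rewrite linearP scalerDr !scalerA mulrC.
Qed.

HB.instance Definition _ X Y q := GRing.isLinear.Build R
  (gtens X Y) (gtens X Y) *:%R (@galg2_act X Y q) (galg2_act_is_linear q).

(** Stated for bundled linear maps, so that linearity of both sides is found by
    inference and no induction on tensors is needed. *)
Lemma linear_tens_eq (U V W : lmodType R) (f h : {linear tens U V -> W}) :
  (forall x y, f (pure x y) = h (pure x y)) -> f =1 h.
Proof.
move=> fh; elim/tens_ind_pure => [|u v IHu IHv|x y]; last exact: fh.
  by rewrite !linear0.
by rewrite !linearD /= IHu IHv.
Qed.

Lemma tens3_ind_pure (U V W : lmodType R) (P : tens (tens U V) W -> Prop) :
  P 0 -> (forall u v, P u -> P v -> P (u + v)) ->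
  (forall x y z, P (pure (pure x y) z)) -> forall u, P u.
Proof.
move=> P0 PD Pp; apply: tens_ind_pure => // u z.
elim/tens_ind_pure: u => [|u v Pu Pv|x y]; last exact: Pp.
  by rewrite -(scale0r 0) pureZl scale0r.
by rewrite pureDl; exact: PD.
Qed.

Lemma quantizesP q (Q : quantization R gT) :
  quantizes q Q <-> forall X Y (u : gtens X Y), Q X Y u = galg2_act q u.
Proof.
split=> [qQ X Y|qQ X Y x y].
  apply: (@linear_tens_eq X Y _ (Q X Y) (@galg2_act X Y q)) => x y.
  by rewrite qQ; apply: eq_bigr => p _; rewrite tens_mapE.
by rewrite qQ; apply: eq_bigr => p _; rewrite tens_mapE.
Qed.

Lemma galg2_actM X Y q r (u : gtens X Y) :
  galg2_act (q * r) u = galg2_act q (galg2_act r u).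
Proof.
rewrite /galg2_act; under eq_bigr do rewrite ffunE scaler_suml.
rewrite exchange_big; apply: eq_bigr => g _ /=.
rewrite (linear_sum (tens_map (gact X g.1) (gact Y g.2))) scaler_sumr.
rewrite (reindex_inj (mulgI g)); apply: eq_bigr => h _ /=.
rewrite mulKg (linearZZ (tens_map (gact X g.1) (gact Y g.2))) /= -scalerA.
congr (_ *: (_ *: _)).
apply: (@linear_tens_eq X Y _ (tens_map _ _)
  (tens_map (gact X g.1) (gact Y g.2) \o tens_map (gact X h.1) (gact Y h.2))).
by move=> x y; rewrite /= !tens_mapE !gactM.
Qed.

(** Restricting the action of R[G x G] along Delta gives the G-module structure
    of the tensor product; this is how Delta enters the action on quantizers. *)
Lemma galg2_act_diag X Y a (u : gtens X Y) :
  galg2_act (galg_diag a) u = galg_act a u.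
Proof.
rewrite /galg2_act /galg_diag /galg_act.
under eq_bigr do rewrite sum_ffunE scaler_suml.
rewrite exchange_big; apply: eq_bigr => g _ /=.
rewrite (bigD1 (g, g)) //= big1 ?addr0 => [|p /negPf np].
  by rewrite galg_scaleE ffunE eqxx mulr1.
by rewrite galg_scaleE ffunE np mulr0 scale0r.
Qed.

Lemma pure_suml (U V : lmodType R) (I : finType) (F : I -> U) (y : V) :
  pure (\sum_i F i) y = \sum_i pure (F i) y.
Proof.
rewrite (big_morph (fun x => pure x y)
  (fun x x' => pureDl x x' y) (id1 := 0)) //.
by rewrite -(scale0r 0) pureZl scale0r.
Qed.

Lemma pure_sumr (U V : lmodType R) (I : finType) (x : U) (F : I -> V) :
  pure x (\sum_i F i) = \sum_i pure x (F i).
Proof.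
rewrite (big_morph (pure x) (pureDr x) (id1 := 0)) //.
by rewrite -(scale0r 0) pureZr scale0r.
Qed.

Lemma galg2_act_tens X Y a b (x : X) (y : Y) :
  galg2_act (galg_tens a b) (pure x y) = pure (galg_act a x) (galg_act b y).
Proof.
rewrite [in RHS]/galg_act pure_suml.
under [RHS]eq_bigr do rewrite pure_sumr.
rewrite pair_bigA; apply: eq_bigr => p _ /=.
by rewrite tens_mapE ffunE pureZl pureZr scalerA.
Qed.

(** * Existence and uniqueness of quantizers *)

Section Coefficient.

Variable p : gT * gT.

Fact tens_coef_bilin :
  bilin (fun a b : galg R gT => (a p.1 * b p.2 : R^o)).
Proof.
split=> [b c a a'|a c b b'] /=.
  by rewrite ffunE galg_scaleE mulrDl -mulrA.
by rewrite ffunE galg_scaleE mulrDr mulrCA.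
Qed.

Definition tens_coef : {linear gtens gregular gregular -> R^o} :=
  tens_lift tens_coef_bilin.

End Coefficient.

Local Notation one2 :=
  (pure (1 : galg R gT) (1 : galg R gT) : gtens gregular gregular).

(** The pure tensors g (x) h are linearly independent in A (x) A: the functional
    tens_coef p reads off the coefficient at p. *)
Lemma tens_coef_act p q : tens_coef p (galg2_act q one2) = q p.
Proof.
rewrite linear_sum (bigD1 p) //= big1 ?addr0 => [|r npr].
  rewrite linearZ tens_mapE /= [tens_coef p _]tens_liftE !ffunE /=.
  by rewrite !mulVg eqxx mulr1 [_ *: _]mulr1.
rewrite linearZ tens_mapE /= [tens_coef p _]tens_liftE !ffunE /=.
rewrite -!eq_mulVg1 -natrM mulnb.
case: andP => [[/eqP r1 /eqP r2]|_]; last exact: scaler0.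
by case/eqP: npr; case: p r r1 r2 => ? ? [? ?] /= -> ->.
Qed.

Lemma galg2_act_inj q r :
  galg2_act q one2 = galg2_act r one2 -> q = r.
Proof.
by move=> qr; apply/ffunP=> p; rewrite -tens_coef_act qr tens_coef_act.
Qed.

Lemma quantizes_unique q r (Q : quantization R gT) :
  quantizes q Q -> quantizes r Q -> q = r.
Proof.
move=> /quantizesP qQ /quantizesP rQ.
by apply: galg2_act_inj; rewrite -qQ rQ.
Qed.

Lemma galg2_act_surj (u : gtens gregular gregular) :
  exists q, u = galg2_act q one2.
Proof.
elim/tens_ind_pure: u => [|u v [q ->] [r ->]|a b].
- by exists 0; rewrite /galg2_act big1 // => p _; rewrite ffunE scale0r.
- exists (q + r); rewrite /galg2_act -big_split; apply: eq_bigr => p _.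
  by rewrite [(q + r) p]ffunE scalerDl.
- exists (galg_tens a b); rewrite galg2_act_tens !galg_act_regular.
  by rewrite !mulr1.
Qed.

Lemma ghom_galg2_act X X' Y Y' (f : ghom X X') (h : ghom Y Y') q u :
  ghom_tens f h (galg2_act q u) = galg2_act q (ghom_tens f h u).
Proof.
apply: (@linear_tens_eq X Y _ (ghom_tens f h \o @galg2_act X Y q)
   (@galg2_act X' Y' q \o ghom_tens f h)) => x y.
rewrite /= linear_sum tens_mapE; apply: eq_bigr => p _.
by rewrite linearZ /= !tens_mapE !ghom_equivariant.
Qed.

(** The Yoneda argument: x (x) y is the image of 1 (x) 1 under a tensor product
    of two morphisms, with which both Q and the action of q commute. *)
Lemma quantizer_exists (Q : quantization R gT) : exists q, quantizes q Q.
Proof.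
have [q Qq] := galg2_act_surj (Q gregular gregular one2).
exists q; apply/quantizesP => X Y.
apply: (@linear_tens_eq X Y _ (Q X Y) (@galg2_act X Y q)) => x y.
have -> : pure x y = ghom_tens (orbit_hom x) (orbit_hom y) one2.
  by rewrite /= tens_mapE /= [LHS]/(pure x y) !orbit_hom1.
by rewrite -quant_natural Qq ghom_galg2_act.
Qed.

(** * The action of units on R[G x G] *)

Lemma galg2_act1 X Y (u : gtens X Y) : galg2_act 1 u = u.
Proof.
apply: (@linear_tens_eq X Y _ (@galg2_act X Y 1) idfun) => x y.
rewrite /= /galg2_act (bigD1 1%g) //= big1 => [|p /negPf np].
  by rewrite addr0 ffunE eqxx scale1r tens_mapE !gact1.
by rewrite ffunE np scale0r.
Qed.

(** This identity and the next three hold because both sides act alike on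
    1 (x) 1, where no convolution product has to be expanded. *)
Lemma galg_tensM a b c d :
  galg_tens (a * c) (b * d) = galg_tens a b * galg_tens c d.
Proof.
apply: galg2_act_inj; rewrite galg2_actM !galg2_act_tens.
by rewrite !galg_act_regular !mulr1.
Qed.

Lemma galg_tens1 : galg_tens 1 1 = 1 :> galg R (gT * gT)%type.
Proof.
by apply: galg2_act_inj; rewrite galg2_act1 galg2_act_tens !galg_act1.
Qed.

Lemma galg_diagM a b : galg_diag (a * b) = galg_diag a * galg_diag b.
Proof.
by apply: galg2_act_inj; rewrite galg2_actM !galg2_act_diag galg_actM.
Qed.

Lemma galg_diag1 : galg_diag 1 = 1 :> galg R (gT * gT)%type.
Proof.
by apply: galg2_act_inj; rewrite galg2_act1 galg2_act_diag galg_act1.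
Qed.

Lemma gunit_act1 q : gunit_act (gunit_one R gT) q = q.
Proof. by rewrite /gunit_act /= galg_diag1 galg_tens1 mul1r mulr1. Qed.

Lemma gunit_actM (l m : gunit R gT) q :
  gunit_act (gunit_mul l m) q = gunit_act l (gunit_act m q).
Proof. by rewrite /gunit_act /= galg_diagM galg_tensM !mulrA. Qed.

(** The inverse-free form, matching the definition of natiso_act. *)
Lemma gunit_actP (l : gunit R gT) q r :
  r = gunit_act l q <-> r * galg_tens l l = galg_diag l * q.
Proof.
split=> [->|lr]; rewrite /gunit_act.
  by rewrite -mulrA -galg_tensM gunit_Vmul galg_tens1 mulr1.
by rewrite -lr -mulrA -galg_tensM gunit_mulV galg_tens1 mulr1.
Qed.

(** * Natural automorphisms of the identity are central units *)

Section UnitNatiso.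

Variables (l : gunit R gT) (lN : natural_units R gT l).

Fact unit_equivariant X g (x : X) :
  galg_act l (gact X g x) = gact X g (galg_act l x).
Proof. by rewrite -!galg_act_basis -!galg_actM lN.1. Qed.

Definition unit_hom X : ghom X X :=
  @GHom R gT X X (@galg_act X l) (@unit_equivariant X).

End UnitNatiso.

Definition unit_natiso (l : gunit R gT) (lN : natural_units R gT l) :
  natiso R gT.
Proof.
apply: (@NatIso R gT (unit_hom lN)).
- by move=> X Y f x; exact: ghom_galg_act.
- move=> X; exists (unit_hom (natural_unitsV lN) X).
  by split=> x /=; rewrite -galg_actM ?gunit_mulV ?gunit_Vmul galg_act1.
- by move=> r /=; rewrite galg_act_triv lN.2 scale1r.
Defined.

(** Naturality along right multiplications gives lam a = l a, and equivariance
    gives lam a = a l; hence l is central, which also makes a one-sided inverse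
    two-sided. *)
Lemma natiso_unit_exists (lam : natiso R gT) :
  exists2 l : gunit R gT, natural_units R gT l &
    forall X (x : X), lam X x = galg_act l x.
Proof.
pose l : galg R gT := lam gregular (1 : galg R gT).
have lamE X (x : X) : lam X x = galg_act l x.
  by rewrite -[in LHS](orbit_hom1 x) -natiso_natural.
have [mu [lamK muK]] := natiso_iso lam gregular.
pose m : galg R gT := mu (1 : galg R gT).
have lC a : l * a = a * l.
  by rewrite -galg_act_regular -lamE ghom_regularE galg_act_regular.
have lm : l * m = 1 by rewrite -galg_act_regular -lamE muK.
have ml : m * l = 1 by rewrite -lC.
exists (GUnit lm ml) => //; split=> //=.
have := natiso_unit lam (1 : R^o).
by rewrite lamE galg_act_triv [_ *: _]mulr1.
Qed.

(** * Transporting a quantization along a natural automorphism *)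

Lemma ghom_tensE X X' Y Y' (f : ghom X X') (h : ghom Y Y') x y :
  ghom_tens f h (pure x y) = pure (f x) (h y).
Proof. exact: tens_mapE. Qed.

Local Arguments ghom_tens : simpl never.

(** The associator and the maps x |-> x (x) r, x |-> r (x) x are turned into
    G-module morphisms, so that natural automorphisms commute with them; this is
    what the coherence and the normalization of a transported quantization
    rest on. *)
Fact assoc_equivariant X Y Z g (u : gtens (gtens X Y) Z) :
  tens_assoc X Y Z (gact (gtens (gtens X Y) Z) g u) =
  gact (gtens X (gtens Y Z)) g (tens_assoc X Y Z u).
Proof.
elim/tens3_ind_pure: u => [|u v IHu IHv|x y z]; first by rewrite !linear0.
  by rewrite !linearD /= IHu IHv.
by rewrite tens_assocE !tens_mapE tens_assocE.
Qed.

Definition assoc_hom X Y Z :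
    ghom (gtens (gtens X Y) Z) (gtens X (gtens Y Z)) :=
  @GHom R gT (gtens (gtens X Y) Z) (gtens X (gtens Y Z))
    (tens_assoc X Y Z) (@assoc_equivariant X Y Z).

Section UnitTensor.

Variables (X : gmod R gT) (r : gtriv R gT).

Definition tens_unitr (x : X) : gtens X (gtriv R gT) := pure x r.
Definition tens_unitl (x : X) : gtens (gtriv R gT) X := pure r x.

Fact tens_unitr_is_linear : linear tens_unitr.
Proof. by move=> c x y; rewrite /tens_unitr pureDl pureZl. Qed.

Fact tens_unitl_is_linear : linear tens_unitl.
Proof. by move=> c x y; rewrite /tens_unitl pureDr pureZr. Qed.

HB.instance Definition _ := GRing.isLinear.Build R X (gtens X (gtriv R gT))
  *:%R tens_unitr tens_unitr_is_linear.
HB.instance Definition _ := GRing.isLinear.Build R X (gtens (gtriv R gT) X)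
  *:%R tens_unitl tens_unitl_is_linear.

Fact tens_unitr_equivariant g x :
  tens_unitr (gact X g x) = gact (gtens X (gtriv R gT)) g (tens_unitr x).
Proof. by rewrite /tens_unitr [RHS]tens_mapE. Qed.

Fact tens_unitl_equivariant g x :
  tens_unitl (gact X g x) = gact (gtens (gtriv R gT) X) g (tens_unitl x).
Proof. by rewrite /tens_unitl [RHS]tens_mapE. Qed.

Definition unitr_hom : ghom X (gtens X (gtriv R gT)) :=
  @GHom R gT X (gtens X (gtriv R gT)) tens_unitr tens_unitr_equivariant.

Definition unitl_hom : ghom X (gtens (gtriv R gT) X) :=
  @GHom R gT X (gtens (gtriv R gT) X) tens_unitl tens_unitl_equivariant.

End UnitTensor.

Section Transport.

Variables (lam mu : natiso R gT) (Q : quantization R gT).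
Hypotheses (lamK : forall X, cancel (lam X) (mu X)).

Definition transport_map X Y (u : gtens X Y) : gtens X Y :=
  lam (gtens X Y) (Q X Y (ghom_tens (mu X) (mu Y) u)).

Fact transport_is_linear X Y : linear (@transport_map X Y).
Proof. by move=> c u v; rewrite /transport_map !linearP. Qed.

HB.instance Definition _ X Y := GRing.isLinear.Build R
  (gtens X Y) (gtens X Y) *:%R (@transport_map X Y) (@transport_is_linear X Y).

Fact transport_equivariant X Y g (u : gtens X Y) :
  transport_map (gact (gtens X Y) g u) = gact (gtens X Y) g (transport_map u).
Proof. by rewrite /transport_map !ghom_equivariant. Qed.

Definition transport_hom X Y : ghom (gtens X Y) (gtens X Y) :=
  @GHom R gT (gtens X Y) (gtens X Y) (@transport_map X Y)
    (@transport_equivariant X Y).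

Lemma transport_pure X Y (x : X) (y : Y) :
  transport_hom X Y (pure x y) =
  lam (gtens X Y) (Q X Y (pure (mu X x) (mu Y y))).
Proof. by rewrite /= /transport_map ghom_tensE. Qed.

Arguments transport_hom : simpl never.

Fact transport_natural X X' Y Y' (f : ghom X X') (h : ghom Y Y') u :
  ghom_tens f h (transport_hom X Y u) = transport_hom X' Y' (ghom_tens f h u).
Proof.
elim/tens_ind_pure: u => [|u v IHu IHv|x y]; first by rewrite !linear0.
  by rewrite !linearD /= IHu IHv.
rewrite transport_pure natiso_natural quant_natural.
by rewrite !ghom_tensE transport_pure !natiso_natural.
Qed.

(** The mu of the outer map cancels the lam of the inner one, so that both sides
    become lam applied to the coherence condition of Q. *)
Fact transport_coherent X Y Z (u : gtens (gtens X Y) Z) :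
  transport_hom X (gtens Y Z)
    (ghom_tens (ghom_id X) (transport_hom Y Z) (tens_assoc X Y Z u)) =
  tens_assoc X Y Z (transport_hom (gtens X Y) Z
    (ghom_tens (transport_hom X Y) (ghom_id Z) u)).
Proof.
elim/tens3_ind_pure: u => [|u v IHu IHv|x y z]; first by rewrite !linear0.
  by rewrite !linearD /= IHu IHv.
rewrite tens_assocE !ghom_tensE.
rewrite !transport_pure !lamK.
rewrite -[tens_assoc X Y Z _]/(assoc_hom X Y Z _) natiso_natural.
congr (lam _ _).
have := quant_coherent Q (pure (pure (mu X x) (mu Y y)) (mu Z z)).
by rewrite !ghom_tensE tens_assocE ghom_tensE.
Qed.

Hypotheses (muK : forall X, cancel (mu X) (lam X)).

(** Q does nothing here and mu fixes r, so what remains is lam (mu x (x) r);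
    naturality along unitr_hom turns it into lam (mu x) (x) r. *)
Fact transport_unitr X (u : gtens X (gtriv R gT)) :
  transport_hom X (gtriv R gT) u = u.
Proof.
elim/tens_ind_pure: u => [|u v IHu IHv|x r]; first by rewrite !linear0.
  by rewrite !linearD /= IHu IHv.
rewrite transport_pure quant_unitr natiso_unit.
by rewrite -[pure _ _]/(unitr_hom X r (mu X x)) -natiso_natural muK.
Qed.

Fact transport_unitl X (u : gtens (gtriv R gT) X) :
  transport_hom (gtriv R gT) X u = u.
Proof.
elim/tens_ind_pure: u => [|u v IHu IHv|r x]; first by rewrite !linear0.
  by rewrite !linearD /= IHu IHv.
rewrite transport_pure quant_unitl natiso_unit.
by rewrite -[pure _ _]/(unitl_hom X r (mu X x)) -natiso_natural muK.
Qed.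

Definition transport : quantization R gT :=
  Quantization transport_natural transport_coherent
    transport_unitr transport_unitl.

Lemma natiso_act_transport : natiso_act lam Q transport.
Proof.
move=> X Y u.
elim/tens_ind_pure: u => [|u v IHu IHv|x y]; first by rewrite !linear0.
  by rewrite !linearD /= IHu IHv.
by rewrite ghom_tensE [LHS]transport_pure !lamK.
Qed.

End Transport.

(** * Orbits *)

(** The two actions agree: at 1 (x) 1 the condition on lam, Q and Q' becomes
    r (l (x) l) = Delta(l) q, and this identity gives it back on all modules. *)
Lemma natiso_actP (lam : natiso R gT) (l : gunit R gT) q r
    (Q Q' : quantization R gT) :
  (forall X (x : X), lam X x = galg_act l x) ->
  quantizes q Q -> quantizes r Q' ->
  natiso_act lam Q Q' <-> r = gunit_act l q.
Proof.
move=> lamE /quantizesP qQ /quantizesP rQ'.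
have lam2 X Y (u : gtens X Y) :
    ghom_tens (lam X) (lam Y) u = galg2_act (galg_tens l l) u.
  elim/tens_ind_pure: u => [|u v IHu IHv|x y]; first by rewrite !linear0.
    by rewrite !linearD /= IHu IHv.
  by rewrite galg2_act_tens ghom_tensE !lamE.
split=> [act|/gunit_actP rE X Y u].
  apply/gunit_actP/galg2_act_inj.
  by rewrite !galg2_actM -lam2 -rQ' act lamE qQ galg2_act_diag.
by rewrite lam2 rQ' -galg2_actM rE galg2_actM galg2_act_diag lamE qQ.
Qed.

Lemma quantizers_gunit_act (l : gunit R gT) q :
  natural_units R gT l -> quantizers R gT q ->
  quantizers R gT (gunit_act l q).
Proof.
move=> lN [Q qQ].
pose lam := unit_natiso lN; pose mu := unit_natiso (natural_unitsV lN).
have lamK X : cancel (lam X) (mu X).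
  by move=> x; rewrite /= -galg_actM gunit_Vmul galg_act1.
have muK X : cancel (mu X) (lam X).
  by move=> x; rewrite /= -galg_actM gunit_mulV galg_act1.
pose Q' := transport Q lamK muK.
have [r rQ'] := quantizer_exists Q'; exists Q'.
suff <- : r = gunit_act l q by [].
by apply/(@natiso_actP lam l q r Q Q') => //; exact: natiso_act_transport.
Qed.

Lemma natiso_orbitE q : quantizers R gT q ->
  natiso_orbit q = gunit_orbit (natural_units R gT) q.
Proof.
move=> [Q qQ]; apply/seteqP; split=> r.
  move=> [lam [Q1 [Q' [qQ1 rQ' act]]]]; split; first by exists Q'.
  have [l lN lamE] := natiso_unit_exists lam; exists l => //.
  by apply/(natiso_actP lamE qQ1 rQ').
move=> [[Q' rQ'] [l lN rE]]; exists (unit_natiso lN), Q, Q'; split=> //.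
exact/(natiso_actP (lam := unit_natiso lN) (fun X x => erefl) qQ rQ').
Qed.

Lemma natiso_orbitsE : natiso_orbits R gT = gunit_orbits (natural_units R gT).
Proof.
by apply/seteqP; split=> _ [q qP <-]; exists q; rewrite ?natiso_orbitE.
Qed.

Lemma augmentation_diag a : augmentation (galg_diag a) = augmentation a.
Proof.
rewrite /augmentation /galg_diag; under eq_bigr do rewrite sum_ffunE.
rewrite exchange_big; apply: eq_bigr => g _ /=.
rewrite (bigD1 (g, g)) //= big1 ?addr0 => [|p /negPf np].
  by rewrite galg_scaleE ffunE eqxx mulr1.
by rewrite galg_scaleE ffunE np mulr0.
Qed.

Lemma augmentation_tens a b :
  augmentation (galg_tens a b) = augmentation a * augmentation b.
Proof.
rewrite /augmentation mulr_suml; under [RHS]eq_bigr do rewrite mulr_sumr.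
by rewrite pair_bigA; apply: eq_bigr => p _; rewrite ffunE.
Qed.

Fact scalar_mul_bilin : bilin (fun r s : R^o => (r * s : R^o)).
Proof.
split=> [s c r r'|r c s s'] /=; first by rewrite mulrDl -mulrA.
by rewrite mulrDr mulrCA.
Qed.

(** On the tensor square of the unit object q acts by its augmentation, while a
    quantization acts by the identity. *)
Lemma augmentation_quantizer q : quantizers R gT q -> augmentation q = 1.
Proof.
move=> [Q qQ].
have := qQ (gtriv R gT) (gtriv R gT) (1 : R^o) (1 : R^o).
rewrite quant_unitr => /(congr1 (tens_lift scalar_mul_bilin)).
rewrite tens_liftE mulr1 linear_sum => ->; apply: eq_bigr => p _.
by rewrite linearZZ tens_liftE mulr1 [RHS]mulr1.
Qed.

(** The augmentation of l(q) is that of l times the square of that of l^-1, so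
    it is the inverse of the augmentation of l. *)
Lemma augmentation_unit_quantizers (l : gunit R gT) q :
  quantizers R gT q -> quantizers R gT (gunit_act l q) -> augmentation l = 1.
Proof.
move=> /augmentation_quantizer q1 /augmentation_quantizer.
rewrite !augmentationM q1 mulr1 augmentation_diag augmentation_tens mulrA.
rewrite -augmentationM gunit_mulV augmentation1 mul1r => linv.
rewrite -[LHS]mulr1 -[X in _ * X = _]linv.
by rewrite -augmentationM gunit_mulV augmentation1.
Qed.

Lemma galg_mulC : commutative (@mulg gT) ->
  forall a b, a * b = b * a.
Proof.
move=> gC a b; apply/ffunP=> k; rewrite !ffunE.
rewrite (reindex_inj (inj_comp (mulIg k) invg_inj)) /=.
by apply: eq_bigr => g _; rewrite invMg invgK -mulgA [(g * k)%g]gC mulKg mulrC.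
Qed.

Lemma gunit_orbit_abelian q : commutative (@mulg gT) -> quantizers R gT q ->
  gunit_orbit [set: gunit R gT] q = gunit_orbit (natural_units R gT) q.
Proof.
move=> gC qP; apply/seteqP; split=> r [rP [l _ rE]]; split=> //; exists l => //.
split; first exact: galg_mulC.
by apply: augmentation_unit_quantizers qP _; rewrite -rE.
Qed.

End GroupAlgebraModule.

Theorem theorem3 (R : comPzRingType) (gT : finGroupType) :
  (* quantizations are identified with their quantizers *)
  (forall Q : quantization R gT, exists! q, quantizes q Q) /\
  (* l(q) := Delta(l) q l^(-(x)2) is a group action on q(G) *)
  ((forall (l : gunit R gT) q,
      natural_units R gT l -> quantizers R gT q ->
      quantizers R gT (gunit_act l q)) /\
   (forall q, gunit_act (gunit_one R gT) q = q) /\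
   (forall (l m : gunit R gT) q,
      gunit_act (gunit_mul l m) q = gunit_act l (gunit_act m q))) /\
  (* the set Q(G) is its orbit space *)
  natiso_orbits R gT = gunit_orbits (natural_units R gT) /\
  (* when G is abelian, all units of R[G] may be used to define the orbits *)
  ((forall g h : gT, (g * h)%g = (h * g)%g) ->
   natiso_orbits R gT = gunit_orbits [set: gunit R gT]).
Proof.
split=> [Q|].
  have [q qQ] := quantizer_exists Q.
  by exists q; split=> // r; exact: quantizes_unique.
split; first by split; [exact: quantizers_gunit_act | split;
  [exact: gunit_act1 | exact: gunit_actM]].
split=> [|gC]; first exact: natiso_orbitsE.
rewrite natiso_orbitsE; apply/seteqP.
by split=> _ [q qP <-]; exists q; rewrite ?gunit_orbit_abelian.
Qed.
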